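(* Let $\epsilon>0$ be fixed and let $p=p(n)\in[0,1]$. (1) If $p(n)\ge(1+\epsilon)\left(\frac{\log n}{n}\right)^{1/3}$ and $(1-p(n))n^2\to\infty$ as $n\to\infty$, then asymptotically almost surely $\Gamma\in\mathcal{G}(n,p)$ lies in $\mathcal{AS}$. (2) If $p(n)\le(1-\epsilon)\left(\frac{\log n}{n}\right)^{1/3}$, then asymptotically almost surely $\Gamma\in\mathcal{G}(n,p)$ does not lie in $\mathcal{AS}$.
   Context: Graphs are finite and simple. $\mathcal{G}(n,p)$ is the random graph on $n$ labelled vertices in which each of the $\binom n2$ possible edges is included independently with probability $p=p(n)$. A property holds asymptotically almost surely (a.a.s.) if its probability tends to $1$ as $n\to\infty$. ''Subgraph'' means induced subgraph, identified with its vertex set. A clique is a complete graph on $t\ge 0$ vertices (the empty graph is a clique). The link $\mathrm{Lk}_\Gamma(v)$ of a vertex $v$ is the subgraph induced by the vertices adjacent to $v$. The join $A\star B$ of graphs $A,B$ is obtained from the disjoint union $A\sqcup B$ by joining every vertex of $A$ to every vertex of $B$. A graph $\Gamma$ is an augmented suspension if it contains an induced subgraph $B=\{w,w'\}\star\Gamma'$, where $w,w'$ are non-adjacent and $\Gamma'$ is not a clique, such that for every vertex $v\in\Gamma-B$ the graph $\mathrm{Lk}_\Gamma(v)\cap\Gamma'$ is not a clique. $\mathcal{AS}$ is the class of augmented suspensions. *)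

(* Defs.v *)
From HB Require Import structures.
From mathcomp Require Import all_boot all_order all_algebra.

Set Implicit Arguments.
Unset Strict Implicit.
Unset Printing Implicit Defensive.

Import GRing.Theory.
Local Open Scope ring_scope.

(* A finite simple graph on the vertex set T is its set of edges, each edge
   being an unordered pair of distinct vertices. *)
Record graph (T : finType) := Graph {
  edges :> {set {set T}};
  edges_card2 : [forall e in edges, #|e| == 2%N]
}.

HB.instance Definition _ (T : finType) := [isSub for @edges T].
HB.instance Definition _ (T : finType) := [Countable of graph T by <:].
HB.instance Definition _ (T : finType) := [Finite of graph T by <:].

Section GraphNotions.
Variables (T : finType) (G : graph T).
Implicit Types (x y v w : T) (A B S : {set T}).

(* Irreflexive, since [set x; x] has only one element. *)
Definition adj x y : bool := [set x; y] \in edges G.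

(* Induced subgraphs are identified with their vertex sets. *)
Definition clique S : bool :=
  [forall x in S, forall y in S, (x != y) ==> adj x y].

Definition link v : {set T} := [set u | adj v u].

(* The subgraph induced by A :|: B is the join of the subgraphs induced by
   A and B. *)
Definition induces_join A B : bool :=
  [disjoint A & B] && [forall a in A, forall b in B, adj a b].

Definition augmented_suspension : bool :=
  [exists w, exists w', exists S : {set T},
    [&& w != w', ~~ adj w w', induces_join [set w; w'] S, ~~ clique S
      & [forall v in ~: ([set w; w'] :|: S), ~~ clique (link v :&: S)]]].

End GraphNotions.

Section RandomGraph.
Variables (R : comNzRingType) (n : nat) (p : R).

Definition gnp_weight (G : graph 'I_n) : R :=
  \prod_(e : {set 'I_n} | #|e| == 2%N) (if e \in edges G then p else 1 - p).

Definition gnp_prob (A : pred (graph 'I_n)) : R := \sum_(G | A G) gnp_weight G.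

(* The edge indicators are mutually independent with mean p;
   for F = set0 this says that the total mass is 1. *)
Lemma gnp_prob_subset (F : {set {set 'I_n}}) :
  [forall e in F, #|e| == 2%N] ->
  gnp_prob (fun G => F \subset edges G) = p ^+ #|F|.
Proof.
move=> F2.
pose a (e : {set 'I_n}) : R := if #|e| == 2%N then p else 0.
pose b (e : {set 'I_n}) : R :=
  if #|e| == 2%N then (if e \in F then 0 else 1 - p) else 1.
have -> : p ^+ #|F| = \prod_e (a e + b e).
  rewrite -prodr_const big_mkcond; apply: eq_bigr => e _; rewrite /a /b.
  have [eF|eF] := boolP (e \in F).
    by move/forall_inP: F2 => /(_ e eF) ->; rewrite addr0.
  by case: ifP => _; rewrite ?add0r // addrC subrK.
rewrite bigA_distr.
rewrite (bigID (fun E : {set {set 'I_n}} =>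
  [forall e in E, #|e| == 2%N] && (F \subset E))) /=.
rewrite [X in _ = _ + X]big1 ?addr0; last first.
  move=> E; rewrite negb_and => /orP[|].
    case/forall_inPn => e eE e2; rewrite (bigD1 e) //= eE /a (negbTE e2).
    by rewrite mul0r.
  case/subsetPn => e eF eE; rewrite (bigD1 e) //= (negbTE eE) /b eF.
  by move/forall_inP: F2 => /(_ e eF) ->; rewrite mul0r.
rewrite /gnp_prob.
rewrite (reindex_omap (op := +%R) (@edges 'I_n)
  (insub : {set {set 'I_n}} -> option (graph 'I_n))) /=; last first.
  by move=> E /andP[E2 _]; rewrite insubT.
apply: eq_big => [G|G FG].
  by rewrite (edges_card2 G) valK eqxx andbT.
rewrite /gnp_weight big_mkcond; apply: eq_bigr => e _; rewrite /a /b.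
have [e2|e2] := boolP (#|e| == 2%N).
  case: ifP => // /negbT eG; rewrite ifN //.
  by apply: contra eG; apply: (subsetP FG).
rewrite ifN //; apply: contra e2 => eG.
by move/forall_inP: (edges_card2 G); apply.
Qed.

End RandomGraph.

(* Main.v *)
Require Import Defs.
From mathcomp Require Import all_boot all_order all_algebra.
From mathcomp Require Import ring.
Set Implicit Arguments.
Unset Strict Implicit.
Unset Printing Implicit Defensive.
Import Order.TTheory GRing.Theory Num.Theory.
Local Open Scope ring_scope.

(* A graph is an augmented suspension iff some non-adjacent pair w, w' whose
   full common neighbourhood S is not a clique is such that every other vertex
   v outside S has N(v) :&: S not a clique. For fixed v, the set of common
   neighbours of v, w, w' is a binomial random subset with parameter p^3, so
   the probability that it is a clique is exactly
   E[p^C(X,2)] with X ~ Bin(n - 3, p^3).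

   Above the threshold, this expectation times 1 + n(1 - p^2) tends to 0, and
   it bounds the conditional probability that a given non-adjacent pair fails.
   It is enough to look at about phi/(1-p) potential pairs: with phi a large
   constant one of them is non-adjacent with probability at least 1 - e^-phi,
   while the expected number of failing pairs is about phi times a null
   sequence.

   Below the threshold, a good pair must at least have a common neighbourhood S
   that dominates the graph. Given S, the events "v has a neighbour in S" are
   independent for v outside S, and |S| <= (1+eps)nP^2 up to an exponentially
   small probability, so a union bound over the n^2 pairs suffices. *)

(** * Expectations over the random graph *)

Section Expectation.
Variables (R : realFieldType) (n : nat) (p : R).
Implicit Types (G H : graph 'I_n) (D : {set {set 'I_n}}) (F : graph 'I_n -> R).

Definition gnp_expect F : R := \sum_G gnp_weight p G * F G.

Lemma gnp_probE (A : pred (graph 'I_n)) :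
  gnp_prob p A = gnp_expect (fun G => (A G)%:R).
Proof.
rewrite /gnp_prob big_mkcond; apply: eq_bigr => G _.
by case: (A G); rewrite ?mulr1 ?mulr0.
Qed.

Lemma eq_gnp_expect F1 F2 : F1 =1 F2 -> gnp_expect F1 = gnp_expect F2.
Proof. by move=> eqF; apply: eq_bigr => G _; rewrite eqF. Qed.

Lemma gnp_expect_subset D : [forall e in D, #|e| == 2%N] ->
  gnp_expect (fun G => (D \subset edges G)%:R) = p ^+ #|D|.
Proof. by move=> D2; rewrite -gnp_probE gnp_prob_subset. Qed.

Lemma gnp_expect1 : gnp_expect (fun=> 1) = 1.
Proof.
rewrite -[RHS](expr0 p) -(cards0 {set 'I_n}) -gnp_expect_subset.
  by apply: eq_gnp_expect => G; rewrite sub0set.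
by apply/forall_inP => e; rewrite inE.
Qed.

Lemma gnp_expectD F1 F2 :
  gnp_expect (fun G => F1 G + F2 G) = gnp_expect F1 + gnp_expect F2.
Proof. by rewrite -big_split; apply: eq_bigr => G _; rewrite mulrDr. Qed.

Lemma gnp_expectB F1 F2 :
  gnp_expect (fun G => F1 G - F2 G) = gnp_expect F1 - gnp_expect F2.
Proof. by rewrite -sumrB; apply: eq_bigr => G _; rewrite mulrBr. Qed.

Lemma gnp_expect_sum (I : finType) (P : pred I) (F : I -> graph 'I_n -> R) :
  gnp_expect (fun G => \sum_(i | P i) F i G) = \sum_(i | P i) gnp_expect (F i).
Proof.
rewrite /gnp_expect exchange_big; apply: eq_bigr => G _.
by rewrite mulr_sumr.
Qed.

Lemma ler_gnp_expect F1 F2 : 0 <= p <= 1 ->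
  (forall G, F1 G <= F2 G) -> gnp_expect F1 <= gnp_expect F2.
Proof.
move=> /andP[p0 p1] leF; apply: ler_sum => G _; apply: ler_wpM2l => //.
by apply: prodr_ge0 => e _; case: ifP => _ //; rewrite subr_ge0.
Qed.

(** Measurability with respect to the indicators of the potential edges in [D]. Disjointness of such
    sets is what yields independence below. *)
Definition determined_by D F :=
  forall G H, {in D, forall e, (e \in edges G) = (e \in edges H)} -> F G = F H.

Lemma determined_byS D D' F :
  D \subset D' -> determined_by D F -> determined_by D' F.
Proof. by move=> /subsetP sD dF G H eqGH; apply: dF => e /sD /eqGH. Qed.

Lemma determined_byM D F1 F2 : determined_by D F1 -> determined_by D F2 ->
  determined_by D (fun G => F1 G * F2 G).
Proof. by move=> d1 d2 G H eqGH; rewrite (d1 G H) // (d2 G H). Qed.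

Lemma determined_byB D F1 F2 : determined_by D F1 -> determined_by D F2 ->
  determined_by D (fun G => F1 G - F2 G).
Proof. by move=> d1 d2 G H eqGH; rewrite (d1 G H) // (d2 G H). Qed.

Lemma determined_by_prod D (I : Type) (r : seq I) (P : pred I)
    (F : I -> graph 'I_n -> R) :
  (forall i, P i -> determined_by D (F i)) ->
  determined_by D (fun G => \prod_(i <- r | P i) F i G).
Proof. by move=> dF G H eqGH; apply: eq_bigr => i /dF; apply. Qed.

Lemma determined_by_subset D : determined_by D (fun G => (D \subset edges G)%:R).
Proof.
move=> G H eqGH; suff -> : (D \subset edges G) = (D \subset edges H) by [].
by apply/subsetP/subsetP => sub e eD; move: (sub e eD); rewrite eqGH.
Qed.

Fact mix_card2 D G H :
  [forall e in (edges G :&: D) :|: (edges H :\: D), #|e| == 2%N].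
Proof.
apply/forall_inP => e; rewrite !inE => /orP[/andP[eG _]|/andP[_ eH]].
  by move/forall_inP: (edges_card2 G); apply.
by move/forall_inP: (edges_card2 H); apply.
Qed.
Definition mix D G H := Graph (mix_card2 D G H).

Lemma in_mix D G H e : (e \in edges (mix D G H)) =
  if e \in D then e \in edges G else e \in edges H.
Proof. by rewrite !inE; case: (e \in D); rewrite ?andbT ?andbF ?orbF. Qed.

Lemma mixK D G H : mix D (mix D G H) (mix D H G) = G.
Proof. by apply/val_inj/setP => e; rewrite !in_mix; case: (e \in D). Qed.

Lemma gnp_weight_mix D G H :
  gnp_weight p (mix D G H) * gnp_weight p (mix D H G) =
  gnp_weight p G * gnp_weight p H.
Proof.
rewrite -!big_split; apply: eq_bigr => e _; rewrite !in_mix.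
by case: (e \in D) => //; apply: mulrC.
Qed.

(* Exchanging two independent samples outside [D] preserves their joint law,
   and turns [F1 G * F2 H] into [F1 G * F2 G]. *)
Lemma gnp_expectM D F1 F2 : determined_by D F1 -> determined_by (~: D) F2 ->
  gnp_expect (fun G => F1 G * F2 G) = gnp_expect F1 * gnp_expect F2.
Proof.
move=> d1 d2.
pose W (GH : graph 'I_n * graph 'I_n) := gnp_weight p GH.1 * gnp_weight p GH.2.
have -> : gnp_expect (fun G => F1 G * F2 G) =
    \sum_GH W GH * (F1 GH.1 * F2 GH.1).
  rewrite -[LHS]mulr1 -gnp_expect1 /gnp_expect big_distrlr /= pair_big /=.
  by apply: eq_bigr => -[G H] _; rewrite /W /= mulr1 mulrAC.
pose s (GH : graph 'I_n * graph 'I_n) := (mix D GH.1 GH.2, mix D GH.2 GH.1).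
have sK : involutive s by move=> [G H]; rewrite /s /= !mixK.
rewrite (reindex_inj (inv_inj sK)) /gnp_expect big_distrlr /= pair_big /=.
apply: eq_bigr => -[G H] _; rewrite /W /= gnp_weight_mix.
have -> : F1 (mix D G H) = F1 G by apply: d1 => e; rewrite in_mix => ->.
have -> : F2 (mix D G H) = F2 H.
  by apply: d2 => e; rewrite inE in_mix => /negbTE->.
exact: mulrACA.
Qed.

(** Mutual independence, by induction on an enumeration of [A]: the factors that remain are
    determined by edges outside [D i], so [gnp_expectM] splits off the factor [F i]. *)
Lemma gnp_expect_prod (I : finType) (A : {set I}) (D : I -> {set {set 'I_n}})
    (F : I -> graph 'I_n -> R) :
  {in A &, forall i j, i != j -> [disjoint D i & D j]} ->
  {in A, forall i, determined_by (D i) (F i)} ->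
  gnp_expect (fun G => \prod_(i in A) F i G) = \prod_(i in A) gnp_expect (F i).
Proof.
move=> disjD dF.
have [r r_uniq rA] : exists2 r : seq I, uniq r & A =i r.
  by exists (enum A); [exact: enum_uniq | move=> i; rewrite mem_enum].
rewrite (eq_gnp_expect (F2 := fun G => \prod_(i <- r) F i G)); last first.
  by move=> G; rewrite big_uniq //; apply: eq_bigl.
rewrite (eq_bigl _ _ rA) -big_uniq //.
have {rA} rA : {subset r <= A} by move=> i; rewrite rA.
elim: r r_uniq rA => [|i r IHr] /= => [_ _|/andP[ir r_uniq] rA].
  rewrite big_nil -[RHS]gnp_expect1.
  by apply: eq_gnp_expect => G; rewrite big_nil.
have iA : i \in A by rewrite rA ?mem_head.
rewrite big_cons -IHr // => [|j jr]; last by rewrite rA // inE jr orbT.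
rewrite -(gnp_expectM (D := D i)) //; last 2 first.
- exact: dF.
- move=> G H eqGH; apply: eq_big_seq => j jr.
  have jA : j \in A by rewrite rA // inE jr orbT.
  apply: (dF j jA) => e eD; apply: eqGH; rewrite inE; apply/negP => eDi.
  have /disjD : i != j by apply: contraNneq ir => ->.
  by move=> /(_ iA jA) /pred0P /(_ e); rewrite /= eDi eD.
by apply: eq_gnp_expect => G; rewrite big_cons.
Qed.

End Expectation.

(** * Binomial random subsets and common neighbourhoods *)

Section BinomialExpectation.
Variable R : realFieldType.
Implicit Types (r x c : R) (phi psi : nat -> R) (m : nat).

Definition binomial_expect m r phi : R :=
  \sum_(k < m.+1) (r ^+ k * (1 - r) ^+ (m - k) * phi k) *+ 'C(m, k).

Lemma sum_subsets_card (T : finType) (M : {set T}) (g : nat -> R) :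
  \sum_(A : {set T} | A \subset M) g #|A| = \sum_(k < #|M|.+1) g k *+ 'C(#|M|, k).
Proof.
(* [inord] is faithful on the sets summed over, since [A \subset M] bounds their size by [#|M|]. *)
rewrite (partition_big (fun A : {set T} => inord #|A| : 'I_#|M|.+1) predT) //=.
apply: eq_bigr => k _; rewrite -cards_draws -sumr_const.
apply: eq_big => [A|A /andP[AM /eqP <-]]; last first.
  by rewrite inordK // ltnS subset_leq_card.
rewrite inE; have [AM|//] := boolP (A \subset M).
by rewrite -val_eqE /= inordK // ltnS subset_leq_card.
Qed.

Lemma ler_binomial_expect m r phi psi : 0 <= r <= 1 ->
  (forall k, (k <= m)%N -> phi k <= psi k) ->
  binomial_expect m r phi <= binomial_expect m r psi.
Proof.
move=> /andP[r0 r1] le_phi; apply: ler_sum => k _; apply: ler_wMn2r.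
apply: ler_wpM2l; last by rewrite le_phi // -ltnS.
by rewrite mulr_ge0 // exprn_ge0 // subr_ge0.
Qed.

Lemma binomial_expectD m r phi psi :
  binomial_expect m r (fun k => phi k + psi k) =
  binomial_expect m r phi + binomial_expect m r psi.
Proof. by rewrite -big_split; apply: eq_bigr => k _; rewrite mulrDr mulrnDl. Qed.

(** The probability generating function of the binomial law. The estimates below dominate the
    integrand by geometric sequences and constants in order to reach this closed form. *)
Lemma binomial_expect_pow m r c x :
  binomial_expect m r (fun k => c * x ^+ k) = c * (1 - r + r * x) ^+ m.
Proof.
rewrite exprDn mulr_sumr; apply: eq_bigr => k _.
rewrite mulrnAr exprMn; congr (_ *+ _).
by rewrite [RHS]mulrCA [c * (_ * _)]mulrCA -mulrA mulrCA.
Qed.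

Lemma binomial_expect_cst m r c : binomial_expect m r (fun=> c) = c.
Proof.
transitivity (binomial_expect m r (fun k => c * 1 ^+ k)).
  by apply: eq_bigr => k _; rewrite expr1n mulr1.
by rewrite binomial_expect_pow mulr1 subrK expr1n mulr1.
Qed.

End BinomialExpectation.

Section CommonNeighbours.
Variables (R : realFieldType) (n : nat) (p : R).
Implicit Types (X A S : {set 'I_n}) (G : graph 'I_n) (u v w : 'I_n).
Local Notation E := (gnp_expect p).

Definition star u X : {set {set 'I_n}} := [set [set u; x] | x in X].

Definition pairs A : {set {set 'I_n}} :=
  [set e : {set 'I_n} | e \subset A & #|e| == 2%N].

Lemma star_card2 u X : u \notin X -> [forall e in star u X, #|e| == 2%N].
Proof.
move=> uX; apply/forall_inP => e /imsetP[x xX ->].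
by rewrite cards2 (_ : u != x) //; apply: contraNneq uX => ->.
Qed.

Lemma card_star u X : u \notin X -> #|star u X| = #|X|.
Proof.
move=> uX; apply: card_in_imset => x y xX yX /setP/(_ x).
rewrite !inE eqxx orbT; have /negbTE-> : x != u by apply: (memPn uX).
by move/esym/eqP.
Qed.

Lemma disjoint_star u v X : u \notin X -> v \notin X -> u != v ->
  [disjoint star u X & star v X].
Proof.
move=> uX vX uv; apply/pred0P => e /=; apply/negbTE/negP.
case/andP => /imsetP[x xX ->] /imsetP[y yX /setP/(_ u)].
rewrite !inE eqxx (negbTE uv) /= => /esym/eqP uy.
by rewrite -uy (negbTE uX) in yX.
Qed.

Lemma pairs_card2 A : [forall e in pairs A, #|e| == 2%N].
Proof. by apply/forall_inP => e; rewrite inE => /andP[]. Qed.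

Lemma card_pairs A : #|pairs A| = 'C(#|A|, 2).
Proof. exact: cards_draws. Qed.

Lemma cliqueE G A : clique G A = (pairs A \subset edges G).
Proof.
apply/forall_inP/subsetP => [cl e|sub x xA].
  rewrite inE => /andP[/subsetP eA /cards2P[x [y [xy ee]]]].
  have xA : x \in A by rewrite eA // ee !inE eqxx.
  have yA : y \in A by rewrite eA // ee !inE eqxx orbT.
  by have /forall_inP/(_ y yA) := cl x xA; rewrite xy ee.
apply/forall_inP => y yA; apply/implyP => xy; apply: sub.
by rewrite inE cards2 xy andbT; apply/subsetP => z; rewrite !inE => /orP[]/eqP->.
Qed.

Lemma cliqueS G A S : A \subset S -> clique G S -> clique G A.
Proof.
rewrite !cliqueE => AS; apply: subset_trans; apply/subsetP => e.
by rewrite !inE => /andP[eA ->]; rewrite (subset_trans eA).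
Qed.

Definition common_nbrs X G := [set u in ~: X | star u X \subset edges G].

(** The potential edges between [X] and its complement, which alone determine [common_nbrs X]. *)
Definition crossing X := \bigcup_(u in ~: X) star u X.

(** Factors the event over the vertices outside [X]; the factors depend on pairwise disjoint stars,
    hence are independent. *)
Lemma common_nbrs_indicator X A G : A \subset ~: X ->
  (common_nbrs X G == A)%:R = \prod_(u in ~: X)
    (if u \in A then (star u X \subset edges G)%:R
     else 1 - (star u X \subset edges G)%:R) :> R.
Proof.
move=> AX; have [<-|neq] := eqVneq.
  rewrite big1 // => u uX; rewrite inE uX /=.
  by case: (star u X \subset edges G); rewrite ?subr0.
suff [u uX ugu] : exists2 u, u \in ~: X & (u \in A) != (star u X \subset edges G).
  rewrite (bigD1 u) //= [X in X * _](_ : _ = 0) ?mul0r //.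
  by move: ugu; case: (u \in A); case: (star _ _ \subset _); rewrite // subrr.
apply/exists_inP; apply: contraNT neq => /exists_inPn eqA; apply/eqP/setP => u.
rewrite inE; have [uX|uX] := boolP (u \in ~: X).
  by move: (eqA u uX); rewrite negbK => /eqP.
by apply/esym/negbTE; apply: contra uX; apply: (subsetP AX).
Qed.

Lemma gnp_expect_common_nbrs_eq X A (F : graph 'I_n -> R) : A \subset ~: X ->
  determined_by (~: crossing X) F ->
  E (fun G => (common_nbrs X G == A)%:R * F G) =
  (p ^+ #|X|) ^+ #|A| * (1 - p ^+ #|X|) ^+ (#|~: X| - #|A|) * E F.
Proof.
move=> AX dF; set r := p ^+ #|X|.
pose f u G : R := if u \in A then (star u X \subset edges G)%:R
     else 1 - (star u X \subset edges G)%:R.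
have df u : determined_by (star u X) (f u).
  move=> G H /(determined_by_subset R); rewrite /f => ->.
  by [].
rewrite (eq_gnp_expect _ (F2 := fun G => (\prod_(u in ~: X) f u G) * F G)).
  rewrite (gnp_expectM p (D := crossing X)) //.
    congr (_ * _); rewrite (gnp_expect_prod p (D := star^~ X)) //.
      rewrite (bigID (mem A)) /=; congr (_ * _).
        rewrite (eq_bigr (fun=> r)) => [|u /andP[uX uA]].
          rewrite prodr_const; congr (_ ^+ _); apply: eq_card => u.
          rewrite unfold_in /= andbC; case: (boolP (u \in A)) => //= uA.
          by rewrite (subsetP AX).
        rewrite (eq_gnp_expect _ (F2 := fun G => (star u X \subset edges G)%:R)).
          rewrite gnp_expect_subset ?card_star ?star_card2 //; by rewrite -in_setC.
        by move=> G; rewrite /f uA.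
      rewrite (eq_bigr (fun=> 1 - r)) => [|u /andP[uX uA]].
        rewrite prodr_const; congr (_ ^+ _).
        rewrite -[in RHS](setIidPr AX) -cardsD; apply: eq_card => u.
        by rewrite unfold_in /= !inE andbC.
      rewrite (eq_gnp_expect _ (F2 := fun G => 1 - (star u X \subset edges G)%:R)).
        rewrite gnp_expectB gnp_expect1 gnp_expect_subset ?card_star ?star_card2 //;
          by rewrite -in_setC.
      by move=> G; rewrite /f (negbTE uA).
    by move=> u v; rewrite !inE => uX vX uv; apply: disjoint_star.
  apply: determined_by_prod => u uX; apply: determined_byS (df u).
  exact: (bigcup_sup u).
by move=> G; rewrite common_nbrs_indicator.
Qed.

(** Condition on the value [A] of the common neighbourhood. This reveals crossing edges only, so
    [F A] keeps its expectation, which depends on the size of [A] alone; that size is binomial with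
    parameter [p ^+ #|X|]. *)
Lemma gnp_expect_common_nbrs X (F : {set 'I_n} -> graph 'I_n -> R) (c : nat -> R) :
  (forall A, A \subset ~: X -> determined_by (~: crossing X) (F A)) ->
  (forall A, A \subset ~: X -> E (F A) = c #|A|) ->
  E (fun G => F (common_nbrs X G) G) =
  binomial_expect (n - #|X|) (p ^+ #|X|) c.
Proof.
move=> dF EF; have cardX : #|~: X| = (n - #|X|)%N.
  by rewrite cardsCs setCK card_ord.
rewrite (eq_gnp_expect _ (F2 := fun G =>
  \sum_(A : {set 'I_n} | A \subset ~: X) (common_nbrs X G == A)%:R * F A G)).
  rewrite gnp_expect_sum /binomial_expect -cardX.
  rewrite -(sum_subsets_card _ (fun k =>
    (p ^+ #|X|) ^+ k * (1 - p ^+ #|X|) ^+ (#|~: X| - k) * c k)).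
  apply: eq_bigr => A AX; rewrite gnp_expect_common_nbrs_eq ?EF //.
  exact: dF.
move=> G; rewrite (bigD1 (common_nbrs X G)) /=; last first.
  by apply/subsetP => u; rewrite inE => /andP[].
rewrite eqxx mul1r big1 ?addr0 // => A /andP[_ /negbTE neq].
by rewrite eq_sym neq mul0r.
Qed.

Lemma pairs_crossing X A : (A \subset X) || (A \subset ~: X) ->
  pairs A \subset ~: crossing X.
Proof.
move=> AX; apply/subsetP => e; rewrite !inE => /andP[eA _].
apply/negP => /bigcupP[u]; rewrite inE => uX /imsetP[x xX ee].
have uA : u \in A by apply: (subsetP eA); rewrite ee !inE eqxx.
have xA : x \in A by apply: (subsetP eA); rewrite ee !inE eqxx orbT.
case/orP: AX => /subsetP AX; first by rewrite (AX u uA) in uX.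
by have := AX x xA; rewrite inE xX.
Qed.

(** Three disjoint families of edges are involved: those inside [X] for [F], the crossing ones for
    the common neighbourhood, and those inside the common neighbourhood for the clique event. *)
Lemma gnp_expect_common_nbrs_clique X (F : graph 'I_n -> R) :
  determined_by (pairs X) F ->
  E (fun G => F G * (clique G (common_nbrs X G))%:R) =
  E F * binomial_expect (n - #|X|) (p ^+ #|X|) (fun k => p ^+ 'C(k, 2)).
Proof.
move=> dF; pose H A G : R := F G * (pairs A \subset edges G)%:R.
rewrite (eq_gnp_expect _ (F2 := fun G => H (common_nbrs X G) G)); last first.
  by move=> G; rewrite /H cliqueE.
rewrite (gnp_expect_common_nbrs (X := X) (F := H)
  (c := fun k => E F * p ^+ 'C(k, 2))).
- rewrite /binomial_expect mulr_sumr; apply: eq_bigr => k _.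
  by rewrite mulrnAr; congr (_ *+ _); apply: mulrCA.
- move=> A AX; apply: determined_byM.
    by apply: (determined_byS (D := pairs X)) dF; rewrite pairs_crossing ?subxx.
  apply: determined_byS (@determined_by_subset R n (pairs A)).
  by rewrite pairs_crossing ?AX ?orbT.
move=> A AX; rewrite (gnp_expectM _ (D := pairs X)) //.
  by rewrite gnp_expect_subset ?pairs_card2 // card_pairs.
apply: determined_byS (@determined_by_subset R n (pairs A)).
apply/subsetP => e.
rewrite !inE => /andP[eA e2]; rewrite e2 andbT; apply/negP => eX.
have /card_gt0P[x xe] : (0 < #|e|)%N by rewrite (eqP e2).
by have := subsetP AX x (subsetP eA x xe); rewrite inE (subsetP eX).
Qed.

End CommonNeighbours.

(** * First-moment bounds for augmented suspensions *)

Section AugmentedSuspension.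
Variables (R : realFieldType) (n : nat) (p : R).
Implicit Types (X A S : {set 'I_n}) (G : graph 'I_n) (u v w : 'I_n).
Local Notation E := (gnp_expect p).

Lemma adj_sym G u v : adj G u v = adj G v u.
Proof. by rewrite /adj setUC. Qed.

Lemma star2_adj G v w w' :
  (star v [set w; w'] \subset edges G) = adj G v w && adj G v w'.
Proof.
apply/subsetP/andP => [sub|[vw vw'] e /imsetP[x]].
  by split; apply: sub; apply: imset_f; rewrite !inE eqxx ?orbT.
by rewrite !inE => /orP[]/eqP-> ->.
Qed.

Lemma star_setU1 G u v X :
  (star u (v |: X) \subset edges G) = adj G u v && (star u X \subset edges G).
Proof. by rewrite /star imsetU1 subUset sub1set. Qed.

Lemma common_nbrs_setU1 G v X : v \notin X ->
  common_nbrs (v |: X) G = link G v :&: common_nbrs X G :\ v.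
Proof.
move=> vX; apply/setP => u; rewrite !inE star_setU1 negb_or adj_sym.
by case: (u == v); case: (u \in X); case: (adj G v u).
Qed.

(** Test the definition with the full common neighbourhood [S] of the pair. If it fails, either [S]
    is a clique or some [v] outside [S] has a link meeting [S] in a clique. In the first case an
    arbitrary [v0] is added, so that both cases concern the common neighbourhood of a triple. *)
Lemma not_augmented_suspension G w w' v0 : w != w' -> v0 \notin [set w; w'] ->
  ~~ augmented_suspension G -> ~~ adj G w w' ->
  clique G (common_nbrs (v0 |: [set w; w']) G) \/
  exists2 v, v \notin [set w; w'] &
    ~~ (star v [set w; w'] \subset edges G) &&
    clique G (common_nbrs (v |: [set w; w']) G).
Proof.
move=> ww' v0X nAS nadj; pose S := common_nbrs [set w; w'] G.
have SP u : (u \in S) = (u \notin [set w; w']) && (adj G u w && adj G u w').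
  by rewrite inE star2_adj in_setC.
have [clS|nclS] := boolP (clique G S).
  left; apply: cliqueS clS; rewrite common_nbrs_setU1 //.
  by rewrite (subset_trans (subD1set _ _)) ?subsetIr.
right.
have /forall_inPn[v] : ~~ [forall v in ~: ([set w; w'] :|: S),
    ~~ clique G (link G v :&: S)].
  apply: contra nAS => goodS; apply/existsP; exists w; apply/existsP; exists w'.
  apply/existsP; exists S; rewrite ww' nadj nclS goodS /= andbT.
  apply/andP; split.
    by apply/pred0P => u /=; rewrite SP; case: (u \in _).
  apply/forall_inP => a aX; apply/forall_inP => b; rewrite SP => /and3P[_ bw bw'].
  by move: aX; rewrite !inE adj_sym => /orP[]/eqP->.
rewrite in_setC in_setU negb_or SP => /andP[vX vS]; rewrite negbK => cl.
exists v => //; rewrite star2_adj; move: vS; rewrite vX /= => -> /=.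
by apply: cliqueS cl; rewrite common_nbrs_setU1 // subD1set.
Qed.

Lemma set2_card3 w w' v : w != w' -> v \notin [set w; w'] ->
  #|v |: [set w; w']| = 3.
Proof. by move=> ww' vX; rewrite cardsU1 vX cards2 ww'. Qed.

Hypothesis p01 : 0 <= p <= 1.

Let clique_bound := binomial_expect (n - 3) (p ^+ 3) (fun k => p ^+ 'C(k, 2)).

Lemma clique_bound_ge0 : 0 <= clique_bound.
Proof.
have /andP[p0 p1] := p01.
rewrite -(binomial_expect_cst (n - 3) (p ^+ 3) 0); apply: ler_binomial_expect.
  by rewrite exprn_ge0 //= exprn_ile1.
by move=> k _; rewrite exprn_ge0.
Qed.

(** Union bound over the two cases of [not_augmented_suspension]. That [w], [w'] are non-adjacent
    and that [v] misses one of them are independent events, both decided by edges inside the triple,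
    hence independent of the clique event. The factor [1 - p] must be kept, since about
    [1 / (1 - p)] pairs will be examined. *)
Lemma prob_nonadjacent_pair_fails w w' : (2 < n)%N -> w != w' ->
  E (fun G => (~~ augmented_suspension G && ~~ adj G w w')%:R) <=
  (1 - p) * (1 + n%:R * (1 - p ^+ 2)) * clique_bound.
Proof.
move=> n3 ww'; set X := [set w; w']; have /andP[p0 p1] := p01.
have cardX : #|X| = 2 by rewrite cards2 ww'.
have /card_gt0P[v0] : (0 < #|~: X|)%N.
  by rewrite cardsCs setCK card_ord cardX subn_gt0.
rewrite in_setC => v0X.
(* [f], [g v] and [K v] are the indicators of these three events, the first two written as
   complements of edge sets being present. *)
pose f G : R := 1 - ([set X] \subset edges G)%:R.
pose g v G : R := 1 - (star v X \subset edges G)%:R.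
pose K v G : R := (clique G (common_nbrs (v |: X) G))%:R.
have X2 : [forall e in [set X], #|e| == 2%N].
  by apply/forall_inP => e; rewrite inE => /eqP->; rewrite cardX.
have Ef : E f = 1 - p.
  by rewrite gnp_expectB gnp_expect1 gnp_expect_subset // cards1.
have Eg v : v \notin X -> E (g v) = 1 - p ^+ 2.
  move=> vX; rewrite gnp_expectB gnp_expect1 gnp_expect_subset ?star_card2 //.
  by rewrite card_star ?cardX.
have df : determined_by [set X] f.
  by apply: determined_byB => //; apply: determined_by_subset.
have dg v : determined_by (star v X) (g v).
  by apply: determined_byB => //; apply: determined_by_subset.
have sX v : [set X] \subset pairs (v |: X).
  by rewrite sub1set inE subsetUr cardX.
have sstar v : v \notin X -> star v X \subset pairs (v |: X).
  move=> vX; apply/subsetP => e estar; rewrite inE.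
  rewrite (forall_inP (star_card2 vX) e estar) andbT.
  case/imsetP: estar => x xX ->; apply/subsetP => y.
  by rewrite !inE => /orP[]/eqP->; [rewrite eqxx | move: xX; rewrite !inE => ->; rewrite orbT].
have EK1 : E (fun G => f G * K v0 G) = (1 - p) * clique_bound.
  rewrite gnp_expect_common_nbrs_clique ?Ef ?set2_card3 //.
  exact: determined_byS df.
have EK2 v : v \notin X ->
    E (fun G => f G * g v G * K v G) = (1 - p) * (1 - p ^+ 2) * clique_bound.
  move=> vX.
  rewrite (gnp_expect_common_nbrs_clique _ (F := fun G => f G * g v G)).
    rewrite (gnp_expectM _ (D := [set X])) ?Ef ?Eg ?set2_card3 //.
    apply: determined_byS (dg v); apply/subsetP => e /imsetP[x xX ->].
    rewrite !inE; apply: contraNneq vX => <-; by rewrite !inE eqxx.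
  apply: determined_byM; first exact: determined_byS df.
  by apply: determined_byS (dg v); apply: sstar.
apply: (@le_trans _ _ (E (fun G => f G * K v0 G +
    \sum_(v in ~: X) f G * g v G * K v G))).
  apply: ler_gnp_expect => // G.
  have fE : f G = (~~ adj G w w')%:R.
    by rewrite /f sub1set /adj; case: (_ \in _); rewrite ?subr0 ?subrr.
  have gE v : g v G = (~~ (star v X \subset edges G))%:R.
    by rewrite /g; case: (_ \subset _); rewrite ?subr0 ?subrr.
  have sum_ge0 (P : pred 'I_n) : 0 <= \sum_(v | P v) f G * g v G * K v G.
    by apply: sumr_ge0 => v _; rewrite fE gE !mulr_ge0 ?ler0n.
  have [/andP[nAS nadj]|_] := boolP (_ && _); last first.
    by rewrite addr_ge0 // fE mulr_ge0 ?ler0n.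
  have [cl|[v vX /andP[nst cl]]] := not_augmented_suspension ww' v0X nAS nadj.
    have -> : f G * K v0 G = 1 by rewrite fE nadj /K cl mulr1.
    by rewrite lerDl sum_ge0.
  rewrite (bigD1 v) ?in_setC //=.
  have -> : f G * g v G * K v G = 1 by rewrite fE gE nadj nst /K cl !mulr1.
  by rewrite addrCA lerDl addr_ge0 ?sum_ge0 // fE mulr_ge0 ?ler0n.
rewrite gnp_expectD gnp_expect_sum EK1.
rewrite (eq_bigr (fun=> (1 - p) * (1 - p ^+ 2) * clique_bound)); last first.
  by move=> v; rewrite in_setC => /EK2.
rewrite sumr_const -[_ *+ #|_|]mulr_natl.
rewrite [leRHS](_ : _ = (1 - p) * clique_bound +
  n%:R * ((1 - p) * (1 - p ^+ 2) * clique_bound)); last by ring.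
rewrite lerD2l; apply: ler_wpM2r.
  by rewrite !mulr_ge0 ?subr_ge0 ?exprn_ile1 ?clique_bound_ge0.
by rewrite ler_nat (leq_trans (max_card _)) // card_ord.
Qed.

(** Fix [K] potential edges. Either all are present, with probability [p ^+ K], or one of them is a
    non-adjacent pair that fails. *)
Lemma prob_not_augmented_suspension (K : nat) : (2 < n)%N -> (K <= 'C(n, 2))%N ->
  gnp_prob p (fun G : graph 'I_n => ~~ augmented_suspension G) <=
  p ^+ K + K%:R * ((1 - p) * (1 + n%:R * (1 - p ^+ 2)) * clique_bound).
Proof.
move=> n3; rewrite -{1}(card_ord n) -cardsT -card_pairs => /card_geqP[s [s_uniq sK sub]].
pose P := [set e in s].
have P2 : [forall e in P, #|e| == 2%N].
  by apply/forall_inP => e; rewrite inE => /sub; rewrite inE => /andP[].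
have <- : #|P| = K by rewrite cardsE (card_uniqP s_uniq).
rewrite gnp_probE.
apply: (@le_trans _ _ (E (fun G => (P \subset edges G)%:R +
   \sum_(e in P) (~~ augmented_suspension G && (e \notin edges G))%:R))).
  apply: ler_gnp_expect => // G.
  have [//|/= nAS] := boolP (augmented_suspension G).
    by rewrite addr_ge0 ?ler0n // sumr_ge0.
  have [_|/subsetPn[e eP eG]] := boolP (P \subset edges G).
    by rewrite lerDl sumr_ge0.
  by rewrite (bigD1 e) //= eG add0r lerDl sumr_ge0.
rewrite gnp_expectD gnp_expect_sum gnp_expect_subset // lerD2l.
rewrite mulr_natl -sumr_const; apply: ler_sum => e /(forall_inP P2)/cards2P[w [w' [ww' ->]]].
exact: prob_nonadjacent_pair_fails.
Qed.

(** An indicator, by [no_edge_toE], written as a product over single edges so that [gnp_expect_prod]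
    applies. *)
Definition no_edge_to v A G : R :=
  \prod_(e in star v A) (1 - ([set e] \subset edges G)%:R).

Lemma no_edge_toE v A G :
  no_edge_to v A G = [forall u in A, ~~ adj G v u]%:R.
Proof.
rewrite /no_edge_to; have [/forall_inP noA|/forall_inPn[u uA]] :=
  boolP [forall u in A, ~~ adj G v u].
  rewrite big1 // => e /imsetP[u uA ->].
  by have := noA u uA; rewrite /adj sub1set => /negbTE->; rewrite subr0.
rewrite negbK => vu; rewrite (bigD1 [set v; u]) /=; last exact: imset_f.
by rewrite sub1set -[_ \in _]/(adj G v u) vu subrr mul0r.
Qed.

Lemma gnp_expect_no_edge_to v A : v \notin A ->
  E (no_edge_to v A) = (1 - p) ^+ #|A|.
Proof.
move=> vA; rewrite (gnp_expect_prod p (D := fun e => [set e])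
  (F := fun e G => 1 - ([set e] \subset edges G)%:R)).
- rewrite -(card_star vA) -prodr_const; apply: eq_bigr => e eA.
  rewrite gnp_expectB gnp_expect1 gnp_expect_subset ?cards1 //.
  by apply/forall_inP => e'; rewrite inE => /eqP->; apply: (forall_inP (star_card2 vA)).
- by move=> e e' _ _ ee'; rewrite disjoints1 inE.
by move=> e _; apply: determined_byB => //; apply: determined_by_subset.
Qed.

Lemma determined_by_no_edge_to v A : determined_by (star v A) (no_edge_to v A).
Proof.
apply: determined_by_prod => e eA; apply: determined_byB => //.
by apply: determined_byS (@determined_by_subset R n [set e]); rewrite sub1set.
Qed.

(** Given a common neighbourhood [A] of size [k], the [n - #|X| - k] other vertices outside [X] have
    pairwise disjoint stars to [A] that avoid the crossing edges. Each of them has a neighbour in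
    [A] with probability [1 - (1 - p) ^+ k], independently. *)
Lemma prob_pair_dominates X :
  E (fun G => \prod_(v in ~: X :\: common_nbrs X G)
      (1 - no_edge_to v (common_nbrs X G) G)) =
  binomial_expect (n - #|X|) (p ^+ #|X|)
    (fun k => (1 - (1 - p) ^+ k) ^+ (n - #|X| - k)).
Proof.
have dF A v : determined_by (star v A) (fun G => 1 - no_edge_to v A G).
  by apply: determined_byB => //; apply: determined_by_no_edge_to.
apply: (gnp_expect_common_nbrs (F := fun A G =>
  \prod_(v in ~: X :\: A) (1 - no_edge_to v A G))) => A AX.
  apply: determined_by_prod => v; rewrite inE => /andP[vA vX].
  apply: determined_byS (dF A v); apply: subset_trans (pairs_crossing (A := ~: X) _).
    apply/subsetP => e estar; rewrite inE (forall_inP (star_card2 vA) e estar) andbT.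
    case/imsetP: estar => x xA ->; apply/subsetP => y; rewrite in_set2.
    by case/orP=> /eqP-> //; apply: (subsetP AX).
  by rewrite subxx orbT.
rewrite (gnp_expect_prod p (D := fun v => star v A)) //.
  rewrite (eq_bigr (fun=> 1 - (1 - p) ^+ #|A|)).
    rewrite prodr_const; congr (_ ^+ _).
    by rewrite cardsD (setIidPr AX) cardsCs setCK card_ord.
  move=> v; rewrite inE => /andP[vA _].
  by rewrite gnp_expectB gnp_expect1 gnp_expect_no_edge_to.
move=> u v; rewrite !inE => /andP[uA _] /andP[vA _]; exact: disjoint_star.
Qed.

(** The suspended side [S] lies in the common neighbourhood of the pair. A vertex with no neighbour
    there has a link disjoint from [S], and the empty graph is a clique. *)
Lemma augmented_suspension_dominates G : augmented_suspension G ->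
  exists w w', w != w' /\
    {in ~: [set w; w'] :\: common_nbrs [set w; w'] G, forall v,
      ~~ [forall u in common_nbrs [set w; w'] G, ~~ adj G v u]}.
Proof.
case/existsP=> w /existsP[w' /existsP[S /and5P[ww' _ /andP[disj joinS] _ goodS]]].
exists w, w'; split=> // v.
have SC : S \subset common_nbrs [set w; w'] G.
  apply/subsetP => u uS.
  have adjS : {in [set w; w'], forall x, adj G u x}.
    move=> x xX; rewrite adj_sym.
    exact: (forall_inP (forall_inP joinS x xX) u uS).
  have uX : u \notin [set w; w'].
    by apply/negP => uX; move/pred0P: disj => /(_ u); rewrite /= uX uS.
  by rewrite inE in_setC uX star2_adj !adjS ?inE ?eqxx ?orbT.
rewrite inE in_setC => /andP[vC vX].
have vS : v \in ~: ([set w; w'] :|: S).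
  by rewrite in_setC in_setU negb_or vX; apply: contra vC; apply: (subsetP SC).
apply: contra (forall_inP goodS v vS) => /forall_inP noC.
apply/forall_inP => x; rewrite !inE => /andP[vx /(subsetP SC)/noC].
by rewrite vx.
Qed.

Lemma prob_augmented_suspension :
  gnp_prob p (fun G : graph 'I_n => augmented_suspension G) <=
  n%:R ^+ 2 * binomial_expect (n - 2) (p ^+ 2)
    (fun k => (1 - (1 - p) ^+ k) ^+ (n - 2 - k)).
Proof.
have /andP[p0 p1] := p01.
pose F (X : {set 'I_n}) (G : graph 'I_n) : R :=
  \prod_(v in ~: X :\: common_nbrs X G) (1 - no_edge_to v (common_nbrs X G) G).
have F_ge0 X G : 0 <= F X G.
  by apply: prodr_ge0 => v _; rewrite no_edge_toE subr_ge0 lern1 leq_b1.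
rewrite gnp_probE.
apply: (@le_trans _ _ (E (fun G => \sum_(x : 'I_n * 'I_n | x.1 != x.2)
   F [set x.1; x.2] G))).
  apply: ler_gnp_expect => // G.
  have [AS|_] := boolP (augmented_suspension G); last by rewrite sumr_ge0.
  have [w [w' [ww' dom]]] := augmented_suspension_dominates AS.
  have F1 : F [set w; w'] G = 1.
    rewrite /F big1 // => v vC; move: (dom v vC).
    by rewrite no_edge_toE => /negbTE->; rewrite subr0.
  by rewrite (bigD1 (w, w')) //= F1 lerDl sumr_ge0.
rewrite gnp_expect_sum.
rewrite (eq_bigr (fun=> binomial_expect (n - 2) (p ^+ 2)
    (fun k => (1 - (1 - p) ^+ k) ^+ (n - 2 - k)))) => [|[w w'] /= ww']; last first.
  by rewrite prob_pair_dominates cards2 ww'.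
rewrite sumr_const -[_ *+ #|_|]mulr_natl ler_wpM2r //; last first.
  rewrite -natrX ler_nat (leq_trans (max_card _)) //.
  by rewrite card_prod card_ord.
rewrite -(binomial_expect_cst (n - 2) (p ^+ 2) 0); apply: ler_binomial_expect.
  by rewrite exprn_ge0 //= exprn_ile1.
move=> k _; rewrite exprn_ge0 // subr_ge0 exprn_ile1 ?subr_ge0 //.
by rewrite lerBlDr lerDl.
Qed.

End AugmentedSuspension.

From mathcomp Require Import all_classical all_reals all_analysis.
From mathcomp Require Import lra zify.
Import Order.TTheory GRing.Theory Num.Theory.
Import numFieldNormedType.Exports.
Local Open Scope classical_set_scope.
Local Open Scope ring_scope.

(** * Asymptotic estimates *)

Section ExponentialBounds.
Variable R : realType.
Implicit Types (x y r p eta P l t : R) (m k K : nat).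

Lemma ler1B_expX x m : 0 <= 1 - x -> (1 - x) ^+ m <= expR (- (m%:R * x)).
Proof.
move=> x1; rewrite -mulrN expRM_natl lerXn2r ?nnegrE ?expR_ge0 //.
exact: expR_ge1Dx.
Qed.

(** One term of the exponential series bounds [expR x] from below. This trades exponential decay for
    as high a power as is wanted. *)
Lemma expRN_le_fact x k : 0 < x -> expR (- x) <= k.+1`!%:R / x ^+ k.+1.
Proof.
move=> x0; rewrite expRN -[leRHS]invrK lef_pV2 ?posrE ?expR_gt0 ?invr_gt0 //.
  rewrite invf_div; apply: le_trans (expR_ge1Dxn k (ltW x0)).
  by rewrite lerDr.
by rewrite divr_gt0 ?exprn_gt0 ?ltr0n ?fact_gt0.
Qed.

(* [p ^ C(k, 2) <= eta ^ (k - 1)] for every [k]; for [k = 0] the right-hand side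
   is [eta^-1], hence the constant factor. *)
Lemma clique_bound_sparse m p r eta : 0 <= p <= eta -> eta <= 1 -> 0 < eta ->
  0 <= r <= 1 ->
  binomial_expect m r (fun k => p ^+ 'C(k, 2)) <=
  eta^-1 * expR (- (m%:R * (r * (1 - eta)))).
Proof.
move=> /andP[p0 p_eta] eta1 eta0 /andP[r0 r1].
apply: (@le_trans _ _ (binomial_expect m r (fun k => eta^-1 * eta ^+ k))).
  apply: ler_binomial_expect => [|[|k] _]; first by rewrite r0.
    by rewrite bin0n expr0 mulr1 invf_ge1.
  rewrite exprS mulKf ?gt_eqF //.
  apply: (@le_trans _ _ (p ^+ k)); last by rewrite lerXn2r ?nnegrE ?(le_trans p0).
  by apply: ler_wiXn2l => //; [exact: le_trans eta1 | rewrite binS bin1 leq_addl].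
rewrite binomial_expect_pow ler_wpM2l ?invr_ge0 ?(ltW eta0) //.
rewrite (_ : 1 - r + r * eta = 1 - r * (1 - eta)); last by ring.
apply: ler1B_expX; rewrite subr_ge0 mulr_ile1 ?subr_ge0 //.
by rewrite lerBlDr lerDl ltW.
Qed.

(* The two terms bound the contributions of [k >= K] and, by
   [1 <= 2 ^ (K - k)], of [k < K]. *)
Lemma clique_bound_dense m K p r : 0 <= p <= 1 -> 0 <= r <= 1 ->
  binomial_expect m r (fun k => p ^+ 'C(k, 2)) <=
  p ^+ 'C(K, 2) + 2 ^+ K * expR (- (m%:R * (r / 2))).
Proof.
move=> /andP[p0 p1] /andP[r0 r1].
apply: (@le_trans _ _
  (binomial_expect m r (fun k => p ^+ 'C(K, 2) + 2 ^+ K * 2^-1 ^+ k))).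
  apply: ler_binomial_expect => [|k _]; first by rewrite r0.
  have half_ge0 : 0 <= 2^-1 :> R by rewrite invr_ge0.
  have [Kk|kK] := leqP K k.
    rewrite -[leLHS]addr0 lerD ?mulr_ge0 ?exprn_ge0 //.
    by apply: ler_wiXn2l => //; apply: leq_bin2l.
  rewrite -[leLHS]add0r lerD ?exprn_ge0 // (le_trans (exprn_ile1 _ _ _)) //.
  rewrite exprVn ler_pdivlMr ?exprn_gt0 // mul1r.
  by rewrite ler_eXn2l ?ltr1n // ltnW.
rewrite binomial_expectD binomial_expect_cst binomial_expect_pow lerD2l.
rewrite ler_wpM2l ?exprn_ge0 //.
rewrite (_ : 1 - r + r * 2^-1 = 1 - r / 2); last by field.
by apply: ler1B_expX; lra.
Qed.

(* The two terms bound the contributions of [k <= t] and, by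
   [1 <= (1 + l) ^ (k - t)], of [k > t]. *)
Lemma domination_bound m (t : nat) p P l : 0 <= p -> p <= P -> P <= 1 -> 0 < l ->
  (t <= m)%N ->
  binomial_expect m (p ^+ 2) (fun k => (1 - (1 - p) ^+ k) ^+ (m - k)) <=
  (1 - (1 - P) ^+ t) ^+ (m - t) + (1 + l) ^- t * (1 + l * P ^+ 2) ^+ m.
Proof.
move=> p0 pP P1 l0 tm; have p1 : p <= 1 := le_trans pP P1.
have P0 : 0 <= P := le_trans p0 pP.
have b01 (x : R) k : 0 <= x <= 1 -> 0 <= 1 - (1 - x) ^+ k <= 1.
  move=> /andP[x0 x1]; rewrite subr_ge0 exprn_ile1 ?subr_ge0 ?lerBlDr ?lerDl //.
  by rewrite exprn_ge0 // subr_ge0.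
have l1 : 0 < 1 + l by rewrite addr_gt0.
apply: (@le_trans _ _ (binomial_expect m (p ^+ 2)
   (fun k => (1 - (1 - P) ^+ t) ^+ (m - t) + (1 + l) ^- t * (1 + l) ^+ k))).
  apply: ler_binomial_expect => [|k km]; first by rewrite exprn_ge0 // exprn_ile1.
  have /andP[bp0 bp1] := b01 p k (introT andP (conj p0 p1)).
  have /andP[bP0 bP1] := b01 P t (introT andP (conj P0 P1)).
  have [kt|tk] := leqP k t.
    rewrite -[leLHS]addr0 lerD //; last first.
      by rewrite mulr_ge0 ?exprn_ge0 ?invr_ge0 ?exprn_ge0 // ltW.
    apply: (@le_trans _ _ ((1 - (1 - P) ^+ t) ^+ (m - k))).
      rewrite lerXn2r ?nnegrE // lerD2l lerN2.
      apply: (@le_trans _ _ ((1 - P) ^+ k)).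
        by apply: ler_wiXn2l => //; rewrite ?subr_ge0 // lerBlDr lerDl.
      by rewrite lerXn2r ?nnegrE ?subr_ge0 // lerD2l lerN2.
    by apply: ler_wiXn2l => //; rewrite leq_sub2l.
  rewrite -[leLHS]add0r lerD ?exprn_ge0 // (le_trans (exprn_ile1 _ _ _)) //.
  rewrite mulrC ler_pdivlMr ?exprn_gt0 // mul1r.
  by rewrite ler_weXn2l ?lerDl ?(ltW l0) ?(ltnW tk).
rewrite binomial_expectD binomial_expect_cst binomial_expect_pow lerD2l.
rewrite ler_wpM2l ?invr_ge0 ?exprn_ge0 ?(ltW l1) //.
rewrite (_ : 1 - p ^+ 2 + p ^+ 2 * (1 + l) = 1 + l * p ^+ 2); last by ring.
have sq_ge0 (x : R) : 0 <= 1 + l * x ^+ 2.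
  by rewrite addr_ge0 // mulr_ge0 ?sqr_ge0 // ltW.
rewrite lerXn2r ?nnegrE // lerD2l ler_wpM2l ?(ltW l0) //.
by rewrite lerXn2r ?nnegrE.
Qed.

(** Invert [1 + y <= expR y] at [y = P / (1 - P)], where [1 + y = (1 - P)^-1]. *)
Lemma expR_lower_1B P : 0 <= P < 1 -> expR (- (P / (1 - P))) <= 1 - P.
Proof.
move=> /andP[P0 P1]; have P1' : 0 < 1 - P by rewrite subr_gt0.
rewrite expRN -[leRHS]invrK lef_pV2 ?posrE ?expR_gt0 ?invr_gt0 //.
apply: le_trans (expR_ge1Dx _).
by rewrite [leRHS](_ : _ = (1 - P)^-1) //; field; apply: lt0r_neq0.
Qed.

(** The first term uses [expR_lower_1B]. The second is a Chernoff bound with tilt [1 + l], where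
    [(1 + l)^-1 = 1 - l / (1 + l)] is at most [expR (- (l / (1 + l)))]. *)
Lemma domination_bound_exp m (t : nat) p P l : 0 <= p -> p <= P -> P < 1 ->
  0 < l -> (t <= m)%N ->
  binomial_expect m (p ^+ 2) (fun k => (1 - (1 - p) ^+ k) ^+ (m - k)) <=
  expR (- ((m - t)%:R * expR (- (t%:R * (P / (1 - P)))))) +
  expR (m%:R * (l * P ^+ 2) - t%:R * (l / (1 + l))).
Proof.
move=> p0 pP P1 l0 tm; have P0 : 0 <= P := le_trans p0 pP.
apply: le_trans (domination_bound p0 pP (ltW P1) l0 tm) _; apply: lerD.
  apply: le_trans (ler1B_expX _ _) _.
    by rewrite subr_ge0 exprn_ile1 ?subr_ge0 ?(ltW P1) // lerBlDr lerDl.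
  rewrite ler_expR lerN2 ler_wpM2l // -mulrN expRM_natl.
  by rewrite lerXn2r ?nnegrE ?expR_ge0 ?subr_ge0 ?(ltW P1) // expR_lower_1B // P0.
rewrite expRD mulrC expRM_natl -mulrN expRM_natl.
have l1 : 0 < 1 + l by rewrite addr_gt0.
apply: ler_pM.
- by rewrite exprn_ge0 // addr_ge0 // mulr_ge0 ?sqr_ge0 // ltW.
- by rewrite invr_ge0 exprn_ge0 // ltW.
- rewrite lerXn2r ?nnegrE ?expR_ge0 ?expR_ge1Dx //.
  by rewrite addr_ge0 // mulr_ge0 ?sqr_ge0 // ltW.
rewrite -exprVn lerXn2r ?nnegrE ?expR_ge0 ?invr_ge0 ?(ltW l1) //.
apply: le_trans (expR_ge1Dx _).
by rewrite [leRHS](_ : _ = (1 + l)^-1) //; field; apply: lt0r_neq0.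
Qed.

End ExponentialBounds.

(** * The clique term above the threshold, for small and for large edge probability *)

Section SupercriticalBounds.
Variable R : realType.
Implicit Types (p q r eta eps : R) (n K k : nat).

Lemma expR_ln_natr n : (0 < n)%N -> expR (ln n%:R) = n%:R :> R.
Proof. by move=> n0; rewrite lnK // posrE ltr0n. Qed.

Lemma ln_natr_ge0 n : 0 <= ln n%:R :> R.
Proof. by case: n => [|n]; [rewrite ln0 | rewrite ln_ge0 ?ler1n]. Qed.

Lemma bin2_ge n : (1 < n)%N -> (n ^ 2 <= 4 * 'C(n, 2))%N.
Proof.
move=> n1; have := mul_bin_diag n 1; rewrite bin1 -mulnn; nia.
Qed.

(** [eta] is chosen so that [(1 + eps) * (1 - eta) = 1 + eps / 2]. The exponential is then of order
    [n ^ (-1 - eps / 2)], which absorbs the factor [2 * n]; [expR 3] pays for [n - 3] in place of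
    [n]. *)
Lemma sparse_bound n p eps eta : 0 < eps -> eta = eps / (2 * (1 + eps)) ->
  (2 < n)%N -> 0 <= p <= eta -> (1 + eps) * (ln n%:R / n%:R) <= p ^+ 3 ->
  (1 + n%:R * (1 - p ^+ 2)) *
    binomial_expect (n - 3) (p ^+ 3) (fun k => p ^+ 'C(k, 2)) <=
  2 * eta^-1 * expR 3 * expR (- (eps / 2 * ln n%:R)).
Proof.
move=> eps0 etaE n3 /andP[p0 p_eta] rL.
have n_gt0 : (0 < n)%N by apply: leq_trans n3.
have n0 : 0 < n%:R :> R by rewrite ltr0n.
have eta0 : 0 < eta by rewrite etaE divr_gt0 ?mulr_gt0 //; lra.
have eta1 : eta <= 1 by rewrite etaE ler_pdivrMr ?mulr_gt0 //; lra.
have p1 : p <= 1 by exact: le_trans eta1.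
have r01 : 0 <= p ^+ 3 <= 1 by rewrite exprn_ge0 // exprn_ile1.
have pp : 0 <= p <= eta by rewrite p0.
have h := clique_bound_sparse (n - 3) pp eta1 eta0 r01.
have L0 := ln_natr_ge0 n.
apply: (@le_trans _ _ (2 * n%:R * (eta^-1 * expR (3 - ln n%:R - eps / 2 * ln n%:R)))).
  apply: ler_pM.
  - by rewrite addr_ge0 // mulr_ge0 // subr_ge0 exprn_ile1.
  - by apply: clique_bound_ge0; rewrite p0.
  - have : n%:R * (1 - p ^+ 2) <= n%:R :> R by rewrite ler_piMr // lerBlDr lerDl exprn_ge0.
    have : 1 <= n%:R :> R by rewrite ler1n.
    lra.
  apply: le_trans h _; rewrite ler_wpM2l ?invr_ge0 ?(ltW eta0) // ler_expR.
  rewrite natrB //.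
  move/andP: r01 => [r0 r1]; set r := p ^+ 3 in rL r0 r1 *; set L := ln _ in rL L0 *.
  have nr : (1 + eps) * L <= n%:R * r.
    by rewrite -ler_pdivrMl // mulrC -mulrA.
  have e1 : (1 + eps) * (1 - eta) = 1 + eps / 2 by rewrite etaE; field; lra.
  have h1 : (1 + eps) * L * (1 - eta) <= n%:R * r * (1 - eta).
    by rewrite ler_wpM2r // subr_ge0.
  have h2 : (1 + eps) * L * (1 - eta) = L + eps / 2 * L.
    by rewrite mulrAC e1; ring.
  have h3 : r * (1 - eta) <= 1 by rewrite mulr_ile1 ?subr_ge0 // lerBlDr lerDl ltW.
  have -> : (n%:R - 3) * (r * (1 - eta)) = n%:R * r * (1 - eta) - 3 * (r * (1 - eta)).
    by ring.
  lra.
rewrite !expRD (expRN (ln _)) expR_ln_natr //.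
set x := expR (3 : R); set y := expR (- _).
by rewrite le_eqVlt; apply/orP; left; apply/eqP; field; rewrite !gt_eqF.
Qed.

(** In the first term [1 - p ^+ 2 <= 2 * q] is retained, since [q] may be tiny and then the decay is
    weak. In the second, [1 - p ^+ 2 <= 1] and [2 <= expR 1] suffice. *)
Lemma dense_bound n K p q : q = 1 - p -> 0 <= p <= 1 ->
  (2 < n)%N -> (1 < K)%N ->
  (1 + n%:R * (1 - p ^+ 2)) *
    binomial_expect (n - 3) (p ^+ 3) (fun k => p ^+ 'C(k, 2)) <=
  (1 + 2 * (q * n%:R)) * expR (- (q * (K%:R ^+ 2 / 4))) +
  2 * n%:R * (expR K%:R * expR (3 - n%:R * (p ^+ 3 / 2))).
Proof.
move=> qE p01 n3 K1; have /andP[p0 p1] := p01.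
have r01 : 0 <= p ^+ 3 <= 1 by rewrite exprn_ge0 // exprn_ile1.
have h := clique_bound_dense (n - 3) K p01 r01; have /andP[r0 r1] := r01.
set f := binomial_expect _ _ _ in h *.
have n_gt0 : (0 < n)%N by apply: leq_trans n3.
have n0 : 0 <= n%:R :> R by [].
have p21 : 1 - p ^+ 2 <= 1 by rewrite lerBlDr lerDl exprn_ge0.
have a0 : 0 <= 1 + n%:R * (1 - p ^+ 2).
  by rewrite addr_ge0 // mulr_ge0 // subr_ge0 exprn_ile1.
apply: le_trans (ler_wpM2l a0 h) _; rewrite mulrDr; apply: lerD.
  apply: ler_pM => //; first by rewrite exprn_ge0.
    rewrite lerD2l mulrC (_ : 2 * (q * n%:R) = 2 * q * n%:R); last by ring.
    by rewrite ler_wpM2r // qE; nra.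
  have q0 : 0 <= q by rewrite qE subr_ge0.
  rewrite (_ : p = 1 - q); last by rewrite qE; ring.
  apply: le_trans (ler1B_expX _ _) _; first by rewrite qE; lra.
  rewrite ler_expR lerN2 mulrC ler_wpM2r // ler_pdivrMr // -natrX -natrM ler_nat.
  by rewrite mulnC bin2_ge.
apply: ler_pM => //.
- have : n%:R * (1 - p ^+ 2) <= n%:R :> R by rewrite ler_piMr.
  have : 1 <= n%:R :> R by rewrite ler1n.
  lra.
apply: ler_pM; rewrite ?exprn_ge0 ?expR_ge0 //.
  rewrite -[X in expR X]mulr1 expRM_natl lerXn2r ?nnegrE ?expR_ge0 //.
  by apply: le_trans (expR_ge1Dx _); lra.
rewrite ler_expR natrB //; lra.
Qed.

End SupercriticalBounds.

(** * Passage to the limit in the clique term *)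

Section Asymptotics.
Variable R : realType.
Implicit Types (c delta eta eps : R) (p u : nat -> R).

Lemma near_natr_ge c : \forall n \near \oo, c <= n%:R.
Proof. by move: c; apply/cvgryPge; apply: cvgr_idn. Qed.

Lemma near_ln_ge c : \forall n \near \oo, c <= ln n%:R.
Proof.
near=> n; rewrite -(expRK c) ler_ln ?posrE ?expR_gt0 //.
  by near: n; apply: near_natr_ge.
by rewrite (lt_le_trans (expR_gt0 c)) //; near: n; apply: near_natr_ge.
Unshelve. all: by end_near. Qed.

Lemma near_divr_le c delta u : 0 < delta ->
  (forall A : R, \forall n \near \oo, A <= u n) ->
  \forall n \near \oo, c / u n <= delta.
Proof.
move=> delta0 uoo; near=> n.
have un : Num.max 1 (c / delta) <= u n by near: n; apply: uoo.
move: un; rewrite ge_max => /andP[u1 uc].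
rewrite ler_pdivrMr ?(lt_le_trans ltr01) // mulrC.
by rewrite -ler_pdivrMr.
Unshelve. all: by end_near. Qed.

Lemma gnp_prob_cvg1 p (A : forall n, pred (graph 'I_n)) :
  (forall n, 0 <= p n <= 1) ->
  (forall delta, 0 < delta ->
     \forall n \near \oo, gnp_prob (p n) (fun G => ~~ A n G) <= delta) ->
  gnp_prob (p n) (A n) @[n --> \oo] --> (1 : R).
Proof.
move=> p01 small; apply/cvgrPdist_le => delta /small; apply: filterS => n.
suff -> : 1 = gnp_prob (p n) (A n) + gnp_prob (p n) (fun G => ~~ A n G).
  rewrite addrAC subrr add0r => h; rewrite ger0_norm // gnp_probE.
  rewrite /gnp_expect; apply: sumr_ge0 => G _; rewrite mulr_ge0 //.
  have /andP[p0 p1] := p01 n.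
  by apply: prodr_ge0 => e _; case: ifP => _ //; rewrite subr_ge0.
rewrite !gnp_probE -gnp_expectD -[LHS](gnp_expect1 n (p n)).
by apply: eq_gnp_expect => G; case: (A n G); rewrite ?addr0 ?add0r.
Qed.

Lemma divn_block_size (n L : nat) : (0 < L)%N -> (4 * L <= n)%N ->
  [/\ (1 < n %/ L)%N, (n <= 2 * L * (n %/ L))%N & (n %/ L * L <= n)%N].
Proof.
move=> L0 Ln; have := divn_eq n L; have := ltn_pmod n L0.
set K := (n %/ L)%N; set r := (n %% L)%N => rL nE.
by split; nia.
Qed.

(** The cutoff [K] of [dense_bound] is taken linear in [n]. It is large enough for [q * K ^ 2] to be
    of order [q * n ^ 2], which diverges, and small enough for [expR K] to use up at most half of
    the decay [expR (- (n * r0 / 2))]. *)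
Lemma dense_bound_small p eta : 0 < eta -> (forall n, 0 <= p n <= 1) ->
  (forall A : R, \forall n \near \oo, A <= (1 - p n) * n%:R ^+ 2) ->
  forall delta, 0 < delta -> \forall n \near \oo, eta <= p n ->
  (1 + n%:R * (1 - p n ^+ 2)) *
    binomial_expect (n - 3) (p n ^+ 3) (fun k => p n ^+ 'C(k, 2)) <= delta.
Proof.
move=> eta0 p01 qoo delta delta0.
pose r0 := eta ^+ 3; have r00 : 0 < r0 by rewrite exprn_gt0.
(* [L >= 4 / r0] makes [K = n %/ L] at most [n * r0 / 4]. *)
pose L := (Num.truncn (4 / r0)).+1.
have Lr0 : 4 <= L%:R * r0.
  rewrite -ler_pdivrMr //.
  by have /andP[_ /ltW] := truncn_itv (divr_ge0 (ler0n R 4) (ltW r00)).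
(* From [K >= n / (2 * L)] it follows that [K ^ 2 / 4 >= c * n ^ 2]. *)
pose c : R := (16 * L%:R ^+ 2)^-1.
have c0 : 0 < c by rewrite invr_gt0 mulr_gt0 // exprn_gt0 // ltr0n.
near=> n => eta_p.
have t1 : 1 <= (1 - p n) * n%:R ^+ 2 by near: n; apply: qoo.
(* With [t = (1 - p n) * n ^ 2], the constant 6 comes from [3 * t * (2 / (c * t) ^ 2)]. Likewise 64
   comes from [2 * n * (2 / (n * r0 / 4) ^ 2)]. *)
have term1 : 6 / c ^+ 2 / ((1 - p n) * n%:R ^+ 2) <= delta / 2.
  by near: n; apply: near_divr_le => //; rewrite divr_gt0.
have term2 : 64 * expR 3 / r0 ^+ 2 / n%:R <= delta / 2.
  by near: n; apply: near_divr_le => [|A]; [rewrite divr_gt0 | apply: near_natr_ge].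
have nL : (4 * L <= n)%N.
  by rewrite -(ler_nat R); near: n; apply: near_natr_ge.
have [K1 nK KL] := divn_block_size (ltn0Sn _) nL.
move: K1 nK KL; set K := (n %/ L)%N => K1 nK KL.
have n3 : (2 < n)%N by apply: leq_trans nL; rewrite /L mulnS.
have n_gt0 : (0 < n)%N by apply: leq_trans n3.
have nR : 0 < n%:R :> R by rewrite ltr0n.
have /andP[p0 p1] := p01 n.
apply: le_trans (dense_bound erefl (p01 n) n3 K1) _.
rewrite [delta]splitr; apply: lerD.
  apply: le_trans term1; move: t1; set t := (1 - p n) * _ => t1.
  have q0 : 0 <= 1 - p n by rewrite subr_ge0.
  have t0 : 0 < t by apply: lt_le_trans t1.
  have qnt : (1 - p n) * n%:R <= t.
    rewrite /t expr2 mulrA ler_peMr //; first by rewrite mulr_ge0.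
    by rewrite ler1n.
  have ct : c * t <= (1 - p n) * (K%:R ^+ 2 / 4).
    rewrite /t mulrCA ler_wpM2l // /c mulrC ler_pdivrMr; last first.
      by rewrite mulr_gt0 // exprn_gt0 // ltr0n.
    have : n%:R <= 2 * L%:R * K%:R :> R by rewrite -!natrM ler_nat.
    move=> h; have : n%:R ^+ 2 <= (2 * L%:R * K%:R) ^+ 2 :> R.
      by rewrite lerXn2r ?nnegrE ?mulr_ge0.
    move/le_trans; apply; rewrite le_eqVlt; apply/orP; left; apply/eqP.
    by field.
  have ct0 : 0 < c * t by rewrite mulr_gt0.
  apply: (@le_trans _ _ (3 * t * (2 / (c * t) ^+ 2))).
    apply: ler_pM; rewrite ?expR_ge0 //.
    - by rewrite addr_ge0 // mulr_ge0 // mulr_ge0.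
    - lra.
    apply: le_trans (expRN_le_fact 1 ct0).
    by rewrite ler_expR lerN2.
  rewrite le_eqVlt; apply/orP; left; apply/eqP; field.
  by rewrite !gt_eqF.
apply: le_trans term2.
have K4 : K%:R <= n%:R * (r0 / 4).
  have h : K%:R * L%:R <= n%:R :> R by rewrite -natrM ler_nat.
  have h1 : K%:R * L%:R * r0 <= n%:R * r0 by rewrite ler_wpM2r // ltW.
  have h2 : K%:R * 4 <= K%:R * (L%:R * r0) by rewrite ler_wpM2l.
  lra.
have rr : r0 <= p n ^+ 3 by rewrite lerXn2r ?nnegrE // ltW.
have nr0 : 0 < n%:R * (r0 / 4) by rewrite mulr_gt0 // divr_gt0.
apply: (@le_trans _ _ (2 * n%:R * (expR 3 * (2 / (n%:R * (r0 / 4)) ^+ 2)))).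
  rewrite ler_wpM2l ?mulr_ge0 // -expRD.
  apply: (@le_trans _ _ (expR (3 - n%:R * (r0 / 4)))).
    rewrite ler_expR.
    have : n%:R * r0 <= n%:R * p n ^+ 3 by rewrite ler_wpM2l // ltW.
    lra.
  rewrite expRD ler_wpM2l ?expR_ge0 //.
  exact: (expRN_le_fact 1 nr0).
rewrite le_eqVlt; apply/orP; left; apply/eqP; set x := expR (3 : R); field.
by rewrite !gt_eqF.
Unshelve. all: by end_near. Qed.

(** The sequence [p] may alternate between the sparse and dense regimes, so the case is decided for
    each [n] separately. This is why [eta <= p n] stands under the eventual quantifier in
    [dense_bound_small]. *)
Lemma clique_term_small p eps : 0 < eps -> (forall n, 0 <= p n <= 1) ->
  (\forall n \near \oo, (1 + eps) * (ln n%:R / n%:R) `^ (3%:R^-1) <= p n) ->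
  (forall A : R, \forall n \near \oo, A <= (1 - p n) * n%:R ^+ 2) ->
  forall delta, 0 < delta -> \forall n \near \oo,
  (1 + n%:R * (1 - p n ^+ 2)) *
    binomial_expect (n - 3) (p n ^+ 3) (fun k => p n ^+ 'C(k, 2)) <= delta.
Proof.
move=> eps0 p01 plarge qoo delta delta0.
pose eta := eps / (2 * (1 + eps)).
have eta0 : 0 < eta by rewrite divr_gt0 ?mulr_gt0 //; lra.
near=> n; have [p_eta|/ltW eta_p] := leP (p n) eta; last first.
  by move: eta_p; near: n; apply: dense_bound_small.
have n3 : (2 < n)%N by near: n; exact: nbhs_infty_ge.
have /andP[p0 p1] := p01 n.
have Ln0 : 0 <= ln n%:R / n%:R :> R by rewrite divr_ge0 ?ln_natr_ge0.
have rL : (1 + eps) * (ln n%:R / n%:R) <= p n ^+ 3.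
  have pn : (1 + eps) * (ln n%:R / n%:R) `^ (3%:R^-1) <= p n by near: n.
  (* Cubing the hypothesis gives the factor [(1 + eps) ^ 3], of which only [1 + eps] is kept. *)
  apply: (@le_trans _ _ (((1 + eps) * (ln n%:R / n%:R) `^ (3%:R^-1)) ^+ 3)).
    rewrite exprMn -[(_ `^ _) ^+ 3]powR_mulrn ?powR_ge0 // -powRrM mulVf // powRr1 //.
    rewrite ler_wpM2r // exprS ler_peMr ?addr_ge0 ?(ltW eps0) //.
    by rewrite exprn_ege1 // lerDl ltW.
  have e0 : 0 <= 1 + eps by lra.
  by rewrite lerXn2r ?nnegrE // mulr_ge0 // powR_ge0.
have pp : 0 <= p n <= eta by rewrite p0.
apply: le_trans (sparse_bound eps0 erefl n3 pp rL) _.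
have L1 : 1 <= ln n%:R :> R by near: n; apply: near_ln_ge.
have e20 : 0 < eps / 2 * ln n%:R by rewrite mulr_gt0 ?divr_gt0 // (lt_le_trans ltr01).
apply: (@le_trans _ _ (2 / eta * expR 3 * (1 / (eps / 2 * ln n%:R)))).
  rewrite ler_wpM2l ?mulr_ge0 ?invr_ge0 ?expR_ge0 ?(ltW eta0) //.
  exact: (expRN_le_fact 0 e20).
rewrite div1r [(eps / 2 * _)^-1]invfM mulrA.
by near: n; apply: near_divr_le => // A; apply: near_ln_ge.
Unshelve. all: by end_near. Qed.

End Asymptotics.

(** * The two sides of the threshold *)

Section Thresholds.
Variable R : realType.
Implicit Types (c delta eta eps : R).

Lemma prob_not_augmented_suspension_small (p : nat -> R) eps :
  0 < eps -> (forall n, 0 <= p n <= 1) ->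
  (\forall n \near \oo, (1 + eps) * (ln n%:R / n%:R) `^ (3%:R^-1) <= p n) ->
  (forall A : R, \forall n \near \oo, A <= (1 - p n) * n%:R ^+ 2) ->
  forall delta, 0 < delta -> \forall n \near \oo,
  gnp_prob (p n) (fun G : graph 'I_n => ~~ augmented_suspension G) <= delta.
Proof.
move=> eps0 p01 plarge qoo delta delta0.
(* Then [expR (- phi) <= 1 / phi = delta / 2]. *)
pose phi := 2 / delta; have phi0 : 0 < phi by rewrite divr_gt0.
near=> n.
have n3 : (2 < n)%N by near: n; exact: nbhs_infty_ge.
have n3R : 3 <= n%:R :> R by rewrite ler_nat.
have /andP[p0 p1] := p01 n.
have t1 : 1 <= (1 - p n) * n%:R ^+ 2 by near: n; apply: qoo.
have t8 : 8 * phi <= (1 - p n) * n%:R ^+ 2 by near: n; apply: qoo.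
have small : (1 + n%:R * (1 - p n ^+ 2)) *
    binomial_expect (n - 3) (p n ^+ 3) (fun k => p n ^+ 'C(k, 2)) <=
    delta / 2 / (phi + 1).
  by near: n; apply: (clique_term_small eps0) => //; rewrite !divr_gt0 // addr_gt0.
move: t1 t8; set q := 1 - p n => t1 t8.
have q0 : 0 < q.
  rewrite lt_neqAle subr_ge0 p1 andbT; apply/eqP => q0.
  by move: t1; rewrite -q0 mul0r ler10.
have q1 : q <= 1 by rewrite /q lerBlDr lerDl.
(* [K * q] lies between [phi] and [phi + 1]: enough pairs for [p ^ K <= expR (- phi)], few enough
   for the union bound. *)
pose K := (Num.truncn (phi / q)).+1.
have /andP[K_le K_gt] := truncn_itv (ltW (divr_gt0 phi0 q0)).
have Kq : phi <= K%:R * q by rewrite -ler_pdivrMr // ltW.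
have Kq1 : K%:R * q <= phi + 1.
  have : K%:R <= phi / q + 1 by rewrite /K -natr1 lerD2r.
  move/(ler_wpM2r (ltW q0))/le_trans; apply.
  by rewrite mulrDl divfK ?gt_eqF // mul1r lerD2l.
(* By [t8], [K] is at most [n ^ 2 / 8 + 1], hence at most [n ^ 2 / 4]. *)
have KC : (K <= 'C(n, 2))%N.
  have h : n%:R ^+ 2 <= 4 * 'C(n, 2)%:R :> R.
    by rewrite -natrX -natrM ler_nat bin2_ge // ltnW.
  have h2 : phi / q <= n%:R ^+ 2 / 8 by rewrite ler_pdivrMr //; lra.
  have h3 : 8 <= n%:R ^+ 2 :> R by nra.
  rewrite -(ler_nat R) /K -natr1; lra.
apply: le_trans (prob_not_augmented_suspension (p01 n) n3 KC) _.
rewrite [leRHS]splitr; apply: lerD.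
  have -> : delta / 2 = 1`!%:R / phi ^+ 1 by rewrite (_ : 1`! = 1)%N // div1r invf_div.
  apply: le_trans (expRN_le_fact 0 phi0).
  rewrite (_ : p n = 1 - q); last by rewrite /q; ring.
  apply: le_trans (ler1B_expX _ _) _; first by rewrite /q; lra.
  by rewrite ler_expR lerN2.
rewrite -[_ * _ * binomial_expect _ _ _]mulrA [K%:R * _]mulrA.
apply: (@le_trans _ _ ((phi + 1) * (delta / 2 / (phi + 1)))).
  apply: ler_pM => //; first by rewrite mulr_ge0 // ltW.
  rewrite mulr_ge0 ?clique_bound_ge0 // addr_ge0 // mulr_ge0 //.
  by rewrite subr_ge0 exprn_ile1.
by rewrite mulrC divfK // gt_eqF // addr_gt0.
Unshelve. all: by end_near. Qed.

(** Here [a] is the threshold and [M] bounds the mean size of the common neighbourhood.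
    [domination_bound_exp] is applied with cutoff [t] just above [(1 + eps) * M] and [l = eps / 2].
    As [M * P = (1 - eps) ^ 3 * L], a set of size [t] leaves a given vertex undominated with
    probability at least of order [n ^ (-1 + eps / 2)]. *)
Lemma subcritical_pair_bound n p eps a : 0 < eps <= 2^-1 -> 0 <= p ->
  p <= (1 - eps) * a -> 0 <= a <= eps / 2 -> a ^+ 3 = ln n%:R / n%:R ->
  (7 < n)%N -> 1 <= ln n%:R :> R ->
  binomial_expect (n - 2) (p ^+ 2) (fun k => (1 - (1 - p) ^+ k) ^+ (n - 2 - k))
  <= expR (- (expR (- 1) * (eps ^+ 2 / 16) * ln n%:R ^+ 2)) +
     expR (- (eps ^+ 2 / 8 * (n%:R * ((1 - eps) * a) ^+ 2))).
Proof.
move=> /andP[eps0 eps2] p0 pP /andP[a0 a_eps] a3 n8 L1.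
set P := (1 - eps) * a in pP *; set M := n%:R * P ^+ 2; set L := ln _ in L1 a3 *.
have n_gt0 : (0 < n)%N by apply: leq_trans n8.
have nR : 0 < n%:R :> R by rewrite ltr0n.
have n8R : 8 <= n%:R :> R by rewrite ler_nat.
have P0 : 0 <= P by rewrite mulr_ge0 // subr_ge0; lra.
have P_eps : P <= eps / 2 by apply: le_trans a_eps; rewrite ler_piMl //; lra.
have M0 : 0 <= M by rewrite mulr_ge0 ?sqr_ge0.
have MP : M * P = (1 - eps) ^+ 3 * L.
  have -> : M * P = n%:R * (1 - eps) ^+ 3 * a ^+ 3 by rewrite /M /P; ring.
  by rewrite a3; field; rewrite gt_eqF.
have M16 : M <= n%:R / 16.
  by rewrite /M ler_wpM2l // expr2; nra.
pose t := (Num.truncn ((1 + eps) * M)).+1.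
have /andP[t_le t_gt] : ((Num.truncn ((1 + eps) * M))%:R <= (1 + eps) * M <
    (Num.truncn ((1 + eps) * M)).+1%:R) by apply: truncn_itv; rewrite mulr_ge0 //; lra.
have t_le1 : t%:R <= (1 + eps) * M + 1 by rewrite /t -natr1 lerD2r.
have hM1 : (1 + eps) * M <= 3 / 2 * M by rewrite ler_wpM2r //; lra.
have t_half : t%:R <= n%:R / 2 - 2 :> R by lra.
have n2 : (n - 2)%:R = n%:R - 2 :> R by rewrite natrB // (leq_trans _ n8).
have tm : (t <= n - 2)%N by rewrite -(ler_nat R) n2; lra.
have l0 : 0 < eps / 2 by rewrite divr_gt0.
have P1 : P < 1 by lra.
apply: le_trans (domination_bound_exp p0 pP P1 l0 tm) _.
apply: lerD; rewrite ler_expR.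
  rewrite lerN2 natrB // n2.
  (* The slack [(1 + eps) * (1 - eps) ^ 3 <= 1 - eps] covers the enlarged cutoff, and [P <= eps / 2]
     limits the loss from dividing by [1 - P]. *)
  have tP : t%:R * (P / (1 - P)) <= (1 - eps / 2) * L + 1.
    rewrite mulrA ler_pdivrMr ?subr_gt0 //.
    have h1 : t%:R * P <= (1 + eps) * ((1 - eps) ^+ 3 * L) + P.
      rewrite -MP; have := ler_wpM2r P0 t_le1; lra.
    have h2 : (1 + eps) * (1 - eps) ^+ 3 <= 1 - eps.
      rewrite exprS mulrCA ler_piMr //; first by lra.
      nra.
    have h3 : (1 + eps) * ((1 - eps) ^+ 3 * L) <= (1 - eps) * L.
      by rewrite mulrA ler_wpM2r //; lra.
    have h4 : 1 - eps <= (1 - eps / 2) * (1 - P).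
      have e0 : 0 <= 1 - eps / 2 by lra.
      have := ler_wpM2l e0 P_eps; have := sqr_ge0 eps; lra.
    have h5 : (1 - eps) * L <= (1 - eps / 2) * (1 - P) * L.
      by rewrite ler_wpM2r //; lra.
    have -> : ((1 - eps / 2) * L + 1) * (1 - P) =
      (1 - eps / 2) * (1 - P) * L + (1 - P) by ring.
    lra.
  apply: (@le_trans _ _ (n%:R / 2 * expR (- ((1 - eps / 2) * L + 1)))); last first.
    apply: ler_pM; rewrite ?expR_ge0 ?divr_ge0 //; first by lra.
    by rewrite ler_expR lerN2.
  have -> : - ((1 - eps / 2) * L + 1) = - 1 - L + eps / 2 * L by ring.
  rewrite !expRD (expRN L) expR_ln_natr //.
  have eL : 0 <= eps / 2 * L by rewrite mulr_ge0 ?(ltW l0) //; lra.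
  (* Only the quadratic growth in [L] is kept of [n ^ (eps / 2)]: under a further exponential it
     already beats [n ^ 2]. *)
  have h : (eps / 2 * L) ^+ 2 / 2 <= expR (eps / 2 * L).
    by apply: le_trans (expR_ge1Dxn 1 eL); rewrite lerDr.
  set x := expR (- 1); have x0 : 0 <= x by apply: expR_ge0.
  have -> : n%:R / 2 * (x / n%:R * expR (eps / 2 * L)) =
      x * (expR (eps / 2 * L) / 2).
    by set y := expR _; field; rewrite gt_eqF.
  rewrite -mulrA ler_wpM2l //; lra.
rewrite n2.
have hM : (n%:R - 2) * (eps / 2 * P ^+ 2) <= eps / 2 * M.
  rewrite /M mulrCA ler_wpM2l ?(ltW l0) // ler_wpM2r ?sqr_ge0 //; lra.
have l1 : 0 < 1 + eps / 2 by lra.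
have ht : (1 + eps) * M * (eps / 2 / (1 + eps / 2)) <= t%:R * (eps / 2 / (1 + eps / 2)).
  by rewrite ler_wpM2r ?(ltW t_gt) // divr_ge0 // ltW.
(* The Chernoff gain is [eps ^ 2 / 4 / (1 + eps / 2)] times [M], and [1 + eps / 2 <= 2]. *)
suff : eps / 2 * M + eps ^+ 2 / 8 * M <= (1 + eps) * M * (eps / 2 / (1 + eps / 2)).
  lra.
rewrite -mulrDl [leRHS]mulrAC ler_wpM2r // mulrA ler_pdivlMr //; nra.
Qed.

Lemma prob_augmented_suspension_bound n p eps a : 0 < eps <= 2^-1 -> 0 <= p <= 1 ->
  p <= (1 - eps) * a -> 0 <= a <= eps / 2 -> a ^+ 3 = ln n%:R / n%:R ->
  (7 < n)%N -> 1 <= ln n%:R :> R ->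
  3 <= expR (- 1) * (eps ^+ 2 / 16) * ln n%:R ->
  gnp_prob p (fun G : graph 'I_n => augmented_suspension G) <=
  1 / ln n%:R + 9`!%:R * (64 / (eps ^+ 2 / 8) ^+ 3) ^+ 3 / n%:R.
Proof.
move=> eps01 p01 pP a01 a3 n8 L1 Lbig; have /andP[p0 _] := p01.
apply: le_trans (prob_augmented_suspension n p01) _.
have h := subcritical_pair_bound eps01 p0 pP a01 a3 n8 L1.
have /andP[eps0 eps2] := eps01; have /andP[a0 _] := a01.
have n_gt0 : (0 < n)%N by apply: leq_trans n8.
have nR : 0 < n%:R :> R by rewrite ltr0n.
apply: le_trans (ler_wpM2l (exprn_ge0 2 (ltW nR)) h) _.
set M := n%:R * _; set c := eps ^+ 2 / 8; rewrite mulrDr.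
set L := ln _ in L1 a3 Lbig *; apply: lerD.
  have L0 : 0 < L by apply: lt_le_trans L1.
  apply: (@le_trans _ _ (expR (- L))); last first.
    by have := expRN_le_fact 0 L0; rewrite (_ : 1`! = 1)%N // expr1.
  rewrite -{1}(expR_ln_natr R n_gt0) -expRM_natl -expRD ler_expR -/L.
  have : 3 * L <= expR (- 1) * (eps ^+ 2 / 16) * L * L by rewrite ler_wpM2r // ltW.
  rewrite expr2; lra.
have c0 : 0 < c by rewrite divr_gt0 ?exprn_gt0.
(* [M ^ 3 = n * (1 - eps) ^ 6 * L ^ 2], where [1 - eps >= 1 / 2] and [L >= 1]. *)
have M3 : n%:R / 64 <= M ^+ 3.
  have -> : M ^+ 3 = n%:R ^+ 3 * (1 - eps) ^+ 6 * (a ^+ 3) ^+ 2 by rewrite /M; ring.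
  have -> : n%:R ^+ 3 * (1 - eps) ^+ 6 * (a ^+ 3) ^+ 2 = n%:R * ((1 - eps) ^+ 6 * L ^+ 2).
    by rewrite a3; field; rewrite gt_eqF.
  rewrite ler_wpM2l ?(ltW nR) //.
  have h1 : 2^-1 ^+ 6 <= (1 - eps) ^+ 6.
    by rewrite lerXn2r ?nnegrE //; lra.
  have h2 : 1 <= L ^+ 2 by rewrite exprn_ege1.
  have -> : 64^-1 = 2^-1 ^+ 6 :> R by field.
  by rewrite -[leLHS]mulr1 ler_pM.
have M0 : 0 < M.
  rewrite lt_neqAle mulr_ge0 ?sqr_ge0 ?(ltW nR) // andbT; apply/eqP => M0.
  by move: M3; rewrite -M0 expr0n /= leNgt divr_gt0.
(* The ninth power of [M] is at least of order [n ^ 3], one power more than the number of pairs. *)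
apply: (@le_trans _ _ (n%:R ^+ 2 * (9`!%:R / (c * M) ^+ 9))).
  by rewrite ler_wpM2l ?exprn_ge0 ?(ltW nR) // (expRN_le_fact 8) // mulr_gt0.
have M9 : (n%:R / 64) ^+ 3 <= M ^+ 9.
  by rewrite (exprM M 3 3) lerXn2r ?nnegrE ?exprn_ge0 ?divr_ge0 // ltW.
apply: (@le_trans _ _ (n%:R ^+ 2 * (9`!%:R / (c ^+ 9 * (n%:R / 64) ^+ 3)))).
  rewrite ler_wpM2l ?exprn_ge0 ?(ltW nR) // ler_wpM2l ?ler0n //.
  have c9 : 0 < c ^+ 9 by rewrite exprn_gt0.
  have M90 : 0 < M ^+ 9 by rewrite exprn_gt0.
  have n90 : 0 < (n%:R / 64) ^+ 3 :> R by rewrite exprn_gt0 // divr_gt0.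
  by rewrite exprMn lef_pV2 ?posrE ?ler_pM2l // pmulr_rgt0.
rewrite le_eqVlt; apply/orP; left; apply/eqP; set F := 9`!%:R; field.
by rewrite !gt_eqF.
Qed.

Lemma prob_augmented_suspension_small (p : nat -> R) eps :
  0 < eps <= 2^-1 -> (forall n, 0 <= p n <= 1) ->
  (\forall n \near \oo, p n <= (1 - eps) * (ln n%:R / n%:R) `^ (3%:R^-1)) ->
  forall delta, 0 < delta -> \forall n \near \oo,
  gnp_prob (p n) (fun G : graph 'I_n => augmented_suspension G) <= delta.
Proof.
move=> eps01 p01 psmall delta delta0; have /andP[eps0 eps2] := eps01.
near=> n.
have n8 : (7 < n)%N by near: n; exact: nbhs_infty_ge.
have n_gt0 : (0 < n)%N by apply: leq_trans n8.
have L1 : 1 <= ln n%:R :> R by near: n; apply: near_ln_ge.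
have Ln0 : 0 <= ln n%:R / n%:R :> R by rewrite divr_ge0 ?ln_natr_ge0.
have pn : p n <= (1 - eps) * (ln n%:R / n%:R) `^ (3%:R^-1) by near: n.
pose a := (ln n%:R / n%:R : R) `^ (3%:R^-1).
have a0 : 0 <= a by apply: powR_ge0.
have a3 : a ^+ 3 = ln n%:R / n%:R.
  by rewrite -powR_mulrn // -powRrM mulVf // powRr1.
have a_eps : a <= eps / 2.
  rewrite -(@ler_pXn2r _ 3) ?nnegrE ?divr_ge0 ?(ltW eps0) // a3.
  (* [n = expR L >= L ^ 2 / 2] gives [L / n <= 2 / L], so it suffices that [2 / L] is small. *)
  have L2 : 2 / ln n%:R <= (eps / 2) ^+ 3.
    near: n; apply: near_divr_le; last exact: near_ln_ge.
    by rewrite exprn_gt0 // divr_gt0.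
  apply: le_trans L2; set L := ln _ in L1 *.
  have L0 : 0 < L by apply: lt_le_trans L1.
  rewrite ler_pdivrMr ?ltr0n // mulrAC ler_pdivlMr // -expr2.
  have := expR_ge1Dxn 1 (ltW L0); rewrite expR_ln_natr // (_ : 2`! = 2) //.
  lra.
have Lbig : 3 <= expR (- 1) * (eps ^+ 2 / 16) * ln n%:R.
  have c0 : 0 < expR (- 1) * (eps ^+ 2 / 16)
    by rewrite mulr_gt0 ?expR_gt0 ?divr_gt0 ?exprn_gt0.
  by rewrite -ler_pdivrMl //; near: n; apply: near_ln_ge.
have a01 : 0 <= a <= eps / 2 by rewrite a0.
apply: le_trans (prob_augmented_suspension_bound eps01 (p01 n) pn a01 a3 n8 L1 Lbig) _.
rewrite [delta]splitr; apply: lerD; near: n; apply: near_divr_le.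
- by rewrite divr_gt0.
- exact: near_ln_ge.
- by rewrite divr_gt0.
- exact: near_natr_ge.
Unshelve. all: by end_near. Qed.

End Thresholds.

Unset Implicit Arguments.

Theorem mainTheorem1 (R : realType) (eps : R) (p : nat -> R)
    (eps_gt0 : 0 < eps) (p01 : forall n : nat, 0 <= p n <= 1) :
  ((\forall n \near \oo,
      (1 + eps) * (ln n%:R / n%:R) `^ (3%:R^-1) <= p n) ->
   (1 - p n) * n%:R ^+ 2 @[n --> \oo] --> +oo ->
   gnp_prob (p n) (fun G : graph 'I_n => augmented_suspension G) @[n --> \oo]
     --> (1 : R))
  /\
  ((\forall n \near \oo,
      p n <= (1 - eps) * (ln n%:R / n%:R) `^ (3%:R^-1)) ->
   gnp_prob (p n) (fun G : graph 'I_n => ~~ augmented_suspension G)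
     @[n --> \oo] --> (1 : R)).
Proof.
split=> [plarge /cvgryPge qoo|psmall].
  apply: gnp_prob_cvg1 => // delta delta0.
  exact: prob_not_augmented_suspension_small eps_gt0 p01 plarge qoo delta delta0.
apply: gnp_prob_cvg1 => // delta delta0.
(* Shrinking [eps] only weakens the upper bound on [p], and it secures [1 - e >= 1 / 2]. *)
pose e : R := Num.min eps 2^-1.
have e01 : 0 < e <= 2^-1 by rewrite lt_min eps_gt0 invr_gt0 ltr0n ge_min lexx orbT.
have pe : \forall n \near \oo, p n <= (1 - e) * (ln n%:R / n%:R) `^ (3%:R^-1).
  apply: filterS psmall => n /le_trans; apply.
  by rewrite ler_wpM2r ?powR_ge0 // lerD2l lerN2 ge_min lexx.
have := prob_augmented_suspension_small e01 p01 pe delta0.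
apply: filterS => n; apply: le_trans; rewrite le_eqVlt; apply/orP; left; apply/eqP.
by apply: eq_bigl => G; rewrite negbK.
Qed.
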